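(* Let $\alpha:\mathbb{R}^d\to(0,2)$ and $n:\mathbb{R}^d\times\mathbb{R}^d\to(0,\infty)$ satisfy Assumptions (H2) and (H3) (stated in the context). Consider the property $$\lim_{r\to0}\ \sup_{0<|x-y|\le r}|x-y|^{\alpha(x)\wedge\alpha(y)-2}\int_{\{\frac{|x-y|}{2}<|z|\le1\}}\langle x-y,z\rangle\bigg[\frac{n(y,z)}{|z|^{d+\alpha(y)}}-\frac{n(x,z)}{|z|^{d+\alpha(x)}}\bigg]dz=0.\qquad( * )$$ (1) If $\alpha_0:=\inf_{x\in\mathbb{R}^d}\alpha(x)>1$, then $( * )$ holds. (2) If $\alpha_2:=\sup_{x\in\mathbb{R}^d}\alpha(x)<1$ and $$\lim_{r\to0}\ \sup_{0<|x-y|\le r}\frac{|\alpha(x)-\alpha(y)|+\sup_{|z|\le1}|n(x,z)-n(y,z)|}{|x-y|^{1-\alpha(x)\wedge\alpha(y)}}=0,\qquad( ** )$$ then $( * )$ holds. In particular, if the two functions $\alpha(x)$ and $x\mapsto n(x,z)$ are Lipschitz continuous (the latter uniformly in $z\in B(1):=\{y\in\mathbb{R}^d:|y|\le1\}$), then $( ** )$ holds true.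
   Context: The functions $\alpha$ and $n$ are Borel measurable; $a\wedge b=\min(a,b)$. (H2) There are constants $0<\alpha_0\le\alpha_2<2$ such that $\alpha(x)\in[\alpha_0,\alpha_2]$ for all $x\in\mathbb{R}^d$, and $$\lim_{|x-y|\to0}|\alpha(x)-\alpha(y)|\log\frac{1}{|x-y|}=0$$ (limit uniform over pairs $x\ne y$ with $|x-y|\to 0$). (H3) There are constants $c_1,c_2>0$ with $c_1\le n(x,z)\le c_2$ for all $x,z\in\mathbb{R}^d$, and $$\lim_{r\to0}\bigg[\sup_{x\in\mathbb{R}^d,\,|z_1-z_2|\le r}|n(x,z_1)-n(x,z_2)|+\sup_{|z|\le1,\,|x-y|\le r}|n(x,z)-n(y,z)|\bigg]=0.$$ *)

(* Defs.v *)
From HB Require Import structures.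
From mathcomp Require Import all_boot all_order all_algebra.
From mathcomp Require Import all_classical all_reals all_analysis.

Set Implicit Arguments.
Unset Strict Implicit.
Unset Printing Implicit Defensive.

Import Order.TTheory GRing.Theory Num.Theory.
Import numFieldNormedType.Exports.

Local Open Scope classical_set_scope.
Local Open Scope ring_scope.

(* The library equips tuples with the sigma-algebra generated by the
   coordinates, which for R^d is the Borel one. measurableTypeR R is R with the
   sigma-algebra on which lebesgue_measure is defined. *)
Notation Rvec R d := (d.-tuple (measurableTypeR R)).

(* Euclidean structure; the norm the library puts on vectors is the sup norm. *)
Section euclidean.
Context {R : realType} {d : nat}.
Implicit Types x y : Rvec R d.

Definition vsub x y : Rvec R d := [tuple (tnth x i : R) - tnth y i | i < d].

Definition vdot x y : R := \sum_(i < d) (tnth x i : R) * tnth y i.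

Definition vnorm x : R := Num.sqrt (vdot x x).

Definition vdist x y : R := vnorm (vsub x y).

End euclidean.

Section lebesgue_succ.
Context (R : realType) (d : nat).
Variable mu : {sigma_finite_measure set (Rvec R d) -> \bar R}.

Definition tcons (p : measurableTypeR R * Rvec R d) : Rvec R d.+1 :=
  [tuple of p.1 :: p.2].

Let tuncons (t : Rvec R d.+1) : measurableTypeR R * Rvec R d :=
  (tnth t ord0, [tuple of behead t]).

Let measurable_tcons : measurable_fun setT tcons.
Proof. exact: measurable_cons. Qed.

Let measurable_tuncons : measurable_fun setT tuncons.
Proof.
apply: measurable_fun_pair; [exact: measurable_tnth|exact: measurable_behead].
Qed.

Let tconsK : cancel tcons tuncons.
Proof. by move=> [a t]; congr pair; apply: val_inj. Qed.

Definition lebesgue_succ : set (Rvec R d.+1) -> \bar R :=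
  pushforward (lebesgue_measure \x mu)%E tcons.

Let lebesgue_succ0 : lebesgue_succ set0 = 0%E.
Proof. by rewrite /lebesgue_succ /pushforward preimage_set0 measure0. Qed.

Let lebesgue_succ_ge0 A : (0 <= lebesgue_succ A)%E.
Proof. exact: measure_ge0. Qed.

Let lebesgue_succ_sigma_additive : semi_sigma_additive lebesgue_succ.
Proof.
move=> F mF tF mUF; rewrite /lebesgue_succ /pushforward preimage_bigcup.
have mpre A : measurable A -> measurable (tcons @^-1` A).
  by move=> mA; rewrite -[X in measurable X]setTI; exact: measurable_tcons.
apply: measure_semi_sigma_additive.
- by move=> n; exact: mpre.
- apply/trivIsetP => /= i j _ _ ij; rewrite -preimage_setI.
  by move/trivIsetP : tF => /(_ _ _ _ _ ij) ->//; rewrite preimage_set0.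
- by rewrite -preimage_bigcup; exact: mpre.
Qed.

HB.instance Definition _ := isMeasure.Build _ _ _ lebesgue_succ
  lebesgue_succ0 lebesgue_succ_ge0 lebesgue_succ_sigma_additive.

Let lebesgue_succ_sigma_finite : sigma_finite setT lebesgue_succ.
Proof.
have /sigma_finiteP[F [UF ndF Foo]] := sigma_finiteT (@lebesgue_measure R).
have /sigma_finiteP[G [UG ndG Goo]] := sigma_finiteT mu.
exists (fun k => tuncons @^-1` (F k `*` G k)).
  rewrite -preimage_bigcup; apply/esym/seteqP; split=> // t _.
  have [k _ Fk] : (\bigcup_k F k) (tuncons t).1 by rewrite -UF.
  have [l _ Gl] : (\bigcup_l G l) (tuncons t).2 by rewrite -UG.
  exists (maxn k l) => //; split.
    by move: Fk; exact/subsetPset/ndF/leq_maxl.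
  by move: Gl; exact/subsetPset/ndG/leq_maxr.
move=> k; have [mF ?] := Foo k; have [mG ?] := Goo k.
have mFG : measurable (F k `*` G k) by exact: measurableX.
split; first by rewrite -[X in measurable X]setTI; exact: measurable_tuncons.
rewrite /lebesgue_succ /pushforward -comp_preimage.
rewrite (_ : tuncons \o tcons = id) ?preimage_id; last exact/funext.
by rewrite product_measure1E// lte_mul_pinfty// ge0_fin_numE.
Qed.

HB.instance Definition _ := Measure_isSigmaFinite.Build _ _ _ lebesgue_succ
  lebesgue_succ_sigma_finite.

End lebesgue_succ.

(* Lebesgue measure on R^d, as the d-fold product of the one on R. *)
Fixpoint lebesgue_vec (R : realType) (d : nat) :
    {sigma_finite_measure set (Rvec R d) -> \bar R} :=
  if d is d'.+1 then lebesgue_succ (lebesgue_vec R d') else dirac [tuple].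

Section stable_like.
Context (R : realType) (d : nat).
Variables (alpha : Rvec R d -> R) (n : Rvec R d -> Rvec R d -> R).

(* Suprema are taken in \bar R, where they need no boundedness proviso. *)

Definition H2 : Prop :=
  (exists a0 a2 : R, [/\ 0 < a0, a0 <= a2, a2 < 2 &
     forall x, a0 <= alpha x <= a2]) /\
  (forall e : R, 0 < e -> exists2 r : R, 0 < r &
     forall x y, 0 < vdist x y < r ->
       `| `|alpha x - alpha y| * ln (1 / vdist x y) | < e).

Definition n_osc_z (r : R) : \bar R :=
  ereal_sup [set s | exists x z1 z2,
    vdist z1 z2 <= r /\ s = `|n x z1 - n x z2|%:E].

Definition n_osc_x (r : R) : \bar R :=
  ereal_sup [set s | exists x y z,
    [/\ vnorm z <= 1, vdist x y <= r & s = `|n x z - n y z|%:E]].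

Definition H3 : Prop :=
  (exists c1 c2 : R, [/\ 0 < c1, 0 < c2 & forall x z, c1 <= n x z <= c2]) /\
  (n_osc_z r + n_osc_x r)%E @[r --> 0^'+] --> 0%E.

(* lim_{r -> 0} sup_{0 < |x - y| <= r} F x y = 0 *)
Definition sup_dist_cvg0 (F : Rvec R d -> Rvec R d -> \bar R) : Prop :=
  ereal_sup [set s | exists x y, 0 < vdist x y <= r /\ s = F x y]
    @[r --> 0^'+] --> 0%E.

Definition jump_density (x z : Rvec R d) : R :=
  n x z / vnorm z `^ (d%:R + alpha x).

Definition drift_difference (x y : Rvec R d) : \bar R :=
  (\int[lebesgue_vec R d]_(z in [set z | (vdist x y / 2 < vnorm z <= 1)%R])
    (vdot (vsub x y) z * (jump_density y z - jump_density x z))%:E)%E.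

Definition drift_condition : Prop :=
  sup_dist_cvg0 (fun x y =>
    (vdist x y `^ (Num.min (alpha x) (alpha y) - 2))%:E
      * drift_difference x y)%E.

Definition modulus_condition : Prop :=
  sup_dist_cvg0 (fun x y =>
    (`|alpha x - alpha y|%:E
       + ereal_sup [set `|n x z - n y z|%:E | z in [set z | (vnorm z <= 1)%R]])
      / (vdist x y `^ (1 - Num.min (alpha x) (alpha y)))%:E)%E.

Definition alpha_lipschitz : Prop :=
  exists L : R, forall x y, `|alpha x - alpha y| <= L * vdist x y.

Definition n_lipschitz : Prop :=
  exists L : R, forall x y z, vnorm z <= 1 ->
    `|n x z - n y z| <= L * vdist x y.

End stable_like.

(* Main.v *)
Require Import Defs.
From HB Require Import structures.
From mathcomp Require Import all_boot all_order all_algebra.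
From mathcomp Require Import all_classical all_reals all_analysis.
From mathcomp Require Import measurable_realfun ring lra.

Set Implicit Arguments.
Unset Strict Implicit.
Unset Printing Implicit Defensive.

Import Order.TTheory GRing.Theory Num.Theory.
Import numFieldNormedType.Exports.

Local Open Scope classical_set_scope.
Local Open Scope ring_scope.

(* Put delta = |x - y|, m the smaller and m + h the larger of alpha x and
   alpha y. For delta / 2 < |z| <= 1 the difference of the jump densities is at
   most (|n x z - n y z| + c (|z|^(-h) - 1)) |z|^(-d-m).
   If alpha > 1, then |z|^(-h) - 1 <= (delta / 2)^(-h) - 1 tends to 0 by the
   logarithmic modulus of alpha, and the integral of |z|^(1-d-m) over
   delta / 2 < |z| <= 1 is O(delta^(1-m)), which cancels the prefactor.
   If alpha < 1, then |z|^(-h) - 1 <= (h / p) |z|^(-h-p) for every p > 0; for p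
   small |z|^(p-d) dominates all the powers that occur and is integrable near 0,
   so the integral is O(delta (h + sup_z |n x z - n y z|)).
   Powers of |z| are integrated over dyadic annuli, bounding the measure of a
   ball by that of the circumscribed cube. *)

(** * Euclidean norm: crude bounds and measurability *)

Section euclidean_facts.
Context {R : realType} {d : nat}.
Implicit Types (x y z : Rvec R d) (a b rho p : R).

Lemma vnorm_ge0 x : 0 <= vnorm x.
Proof. exact: sqrtr_ge0. Qed.

Lemma coord_le_vnorm x i : `|tnth x i : R| <= vnorm x.
Proof.
rewrite -sqrtr_sqr ler_wsqrtr// expr2 /vdot (bigD1 i)//= lerDl.
by apply: sumr_ge0 => j _; rewrite -expr2 sqr_ge0.
Qed.

(* The factor d, absent from Cauchy-Schwarz, only affects constants. *)
Lemma vdot_le x y : `|vdot x y| <= d%:R * vnorm x * vnorm y.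
Proof.
rewrite /vdot (le_trans (ler_norm_sum _ _ _))//.
apply: (@le_trans _ _ (\sum_(i < d) vnorm x * vnorm y)).
  by apply: ler_sum => i _; rewrite normrM ler_pM// coord_le_vnorm.
by rewrite sumr_const card_ord -[leLHS]mulr_natl mulrA.
Qed.

(** Guarantees that the suprema over pairs at small distance range over nonempty sets; over an empty
    set they would be -oo. *)
Lemma vdist_exists rho : (0 < d)%N -> 0 < rho -> exists x y, vdist x y = rho.
Proof.
move=> d0 rho0.
pose c : R := rho / Num.sqrt d%:R.
exists [tuple c | i < d], [tuple 0 | i < d].
rewrite /vdist /vnorm /vdot.
under eq_bigr do rewrite !tnth_mktuple subr0.
rewrite sumr_const card_ord -mulr_natl -expr2 exprMn exprVn.
rewrite sqr_sqrtr ?ler0n// mulrCA divff ?mulr1 ?pnatr_eq0 -?lt0n//.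
by rewrite sqrtr_sqr gtr0_norm.
Qed.

Lemma measurable_vdot x : measurable_fun [set: Rvec R d] (vdot x).
Proof.
apply: measurable_sum => i; apply: measurable_funM => //.
exact: measurable_tnth.
Qed.

Lemma measurable_vnorm : measurable_fun [set: Rvec R d] (@vnorm R d).
Proof.
rewrite (_ : @vnorm R d = Num.sqrt \o (fun x => vdot x x))//.
apply: measurableT_comp.
  by apply: continuous_measurable_fun; exact: sqrt_continuous.
by apply: measurable_sum => i; apply: measurable_funM; exact: measurable_tnth.
Qed.

Definition annulus a b : set (Rvec R d) := [set z | a < vnorm z <= b].

Lemma measurable_annulus a b : measurable (annulus a b).
Proof.
rewrite (_ : annulus a b = @vnorm R d @^-1` [set` `]a, b]]).
  by rewrite -[X in measurable X]setTI; exact: measurable_vnorm.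
by apply/seteqP; split => z /=; rewrite in_itv.
Qed.

Lemma measurable_vnorm_powR p :
  measurable_fun [set: Rvec R d] (fun z => vnorm z `^ p).
Proof.
by apply: (measurableT_comp (measurable_powR p)); exact: measurable_vnorm.
Qed.

Lemma measurable_vnorm_powR_EFin A p :
  measurable_fun A (fun z : Rvec R d => (vnorm z `^ p)%:E).
Proof.
apply: measurable_funTS; apply/measurable_EFinP; exact: measurable_vnorm_powR.
Qed.

End euclidean_facts.

(** * Volume of cubes *)

Definition cube (R : realType) d (rho : R) : set (Rvec R d) :=
  [set z | forall i, `|tnth z i : R| <= rho].

Lemma measurable_cube (R : realType) d (rho : R) : measurable (@cube R d rho).
Proof.
rewrite (_ : cube rho =
    \bigcap_(i : 'I_d) ((@tnth d R)^~ i @^-1` [set` `[- rho, rho]])).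
  apply: fin_bigcap_measurable => // i _.
  by rewrite -[X in measurable X]setTI; exact: measurable_tnth.
apply/seteqP; split => z /= zr i.
  by move=> _ /=; rewrite in_itv/= -ler_norml.
by have := zr i I; rewrite /= in_itv/= -ler_norml.
Qed.

(** Induction on the dimension: through [tcons] a cube is the product of an interval and a cube one
    dimension lower. In dimension 0 the measure is a Dirac mass, at most 1. *)
Lemma lebesgue_vec_cube (R : realType) d (rho : R) : 0 <= rho ->
  (lebesgue_vec R d (cube rho) <= ((2 * rho) ^+ d)%:E)%E.
Proof.
move=> rho0; elim: d => [|d IH].
  by rewrite expr0 /= diracE lee_fin lern1 leq_b1.
rewrite /= /lebesgue_succ /pushforward.
rewrite (_ : _ @^-1` _ = [set` `[- rho, rho]] `*` @cube R d rho).
  rewrite product_measure1E//; last exact: measurable_cube.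
  have itv : lebesgue_measure [set` `[- rho, rho]] = (2 * rho)%:E.
    rewrite lebesgue_measure_itv/= lte_fin -EFinB.
    (* When [- rho < rho] fails, rho is 0 and so is [2 * rho]. *)
    by case: ltP => h; congr EFin; lra.
  rewrite exprS EFinM; apply: lee_pmul => //.
  by rewrite -itv.
apply/seteqP; split => -[a z] /=.
  move=> h; split => /=.
    by rewrite in_itv/= -ler_norml; have := h ord0.
  move=> i; have := h (lift ord0 i).
  by rewrite tnthS.
move=> [/=]; rewrite in_itv/= -ler_norml => ha hz i.
by case: (unliftP ord0 i) => [j|] ->; rewrite ?tnthS ?tnth0//; exact: hz.
Qed.

(** * Monotonicity of real powers *)

Lemma le0_ler_powR (R : realType) (a b q : R) :
  0 < a -> a <= b -> q <= 0 -> b `^ q <= a `^ q.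
Proof.
move=> a0 ab q0; have b0 : 0 < b by exact: lt_le_trans ab.
rewrite -[q]opprK !(powRN _ (- q)) lef_pV2 ?posrE ?powR_gt0//.
by rewrite ge0_ler_powR ?nnegrE ?oppr_ge0// ltW.
Qed.

Lemma half_powR_lt1 (R : realType) (p : R) : 0 < p -> 2^-1 `^ p < 1.
Proof.
move=> p0; have := gt0_ltr_powR p0 (x := 2^-1) (y := 1).
by rewrite powR1 !nnegrE; apply; lra.
Qed.

(** * Integrals of powers of |z| over annuli *)

Section annulus_integral.
Context {R : realType} {d : nat}.
Implicit Types (a b rho p q : R).

Let mu : {sigma_finite_measure set (Rvec R d) -> \bar R} := lebesgue_vec R d.

Lemma measure_annulus_le a rho : 0 <= rho ->
  (mu (annulus a rho) <= ((2 * rho) ^+ d)%:E)%E.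
Proof.
move=> rho0; apply: le_trans (lebesgue_vec_cube d rho0).
apply: le_measure; rewrite ?inE; [exact: measurable_annulus|
  exact: measurable_cube|].
by move=> z /= /andP[_ zr] i; exact: le_trans (coord_le_vnorm _ _) zr.
Qed.

(** As q <= 0, the integrand is at most its value (rho / 2)^q on the inner sphere, and the shell
    fits in a cube of side 2 rho. *)
Lemma integral_dyadic_annulus_le q rho : 0 < rho -> q <= 0 ->
  (\int[mu]_(z in annulus (rho / 2) rho) (vnorm z `^ q)%:E <=
   (2 ^+ d * 2^-1 `^ q * rho `^ (q + d%:R))%:E)%E.
Proof.
move=> rho0 q0.
have mA := @measurable_annulus R d (rho / 2) rho.
apply: (@le_trans _ _
  (\int[mu]_(z in annulus (rho / 2) rho) (cst ((rho / 2) `^ q)%:E z))%E).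
  apply: ge0_le_integral => //.
  - by move=> z _; rewrite lee_fin powR_ge0.
  - exact: measurable_vnorm_powR_EFin.
  - move=> z /andP[z1 _]; rewrite lee_fin le0_ler_powR ?divr_gt0//.
    exact: ltW.
rewrite integral_cst//.
apply: (@le_trans _ _ (((rho / 2) `^ q)%:E * ((2 * rho) ^+ d)%:E)%E).
  by rewrite lee_wpmul2l ?lee_fin ?powR_ge0// measure_annulus_le// ltW.
rewrite -EFinM lee_fin powRM ?(ltW rho0)// exprMn powRD ?(gt_eqF rho0) ?implybT//.
by rewrite (powR_mulrn _ (ltW rho0)) le_eqVlt; apply/orP; left; apply/eqP; ring.
Qed.

(** Peels off one dyadic shell at a time: the shell of outer radius 2^(-k) contributes a multiple of
    2^(-kp). The sign of p is left free, so that both the bounded and the growing case follow. *)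
Lemma integral_annulus_le_geometric p K : p <= d%:R ->
  (\int[mu]_(z in annulus (2^-1 ^+ K) 1) (vnorm z `^ (p - d%:R))%:E <=
   (2 ^+ d * 2^-1 `^ (p - d%:R) * \sum_(k < K) (2^-1 `^ p) ^+ k)%:E)%E.
Proof.
move=> pd; elim: K => [|K IH].
  rewrite big_ord0 mulr0 expr0 (_ : annulus 1 1 = set0) ?integral_set0//.
  by rewrite -subset0 => z /= /andP[h1 h2]; have := lt_le_trans h1 h2; rewrite ltxx.
have h0 : 0 < 2^-1 ^+ K :> R by rewrite exprn_gt0// invr_gt0.
have h1 : 2^-1 ^+ K <= 1 :> R by rewrite exprn_ile1//; lra.
rewrite (_ : annulus _ _ = annulus (2^-1 ^+ K / 2) (2^-1 ^+ K) `|`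
    annulus (2^-1 ^+ K) 1); last first.
  rewrite exprS mulrC; apply/seteqP; split => z /=; rewrite /annulus/=.
    move=> /andP[z1 z2]; case: (leP (vnorm z) (2^-1 ^+ K)) => h.
      by left; rewrite z1.
    by right; rewrite z2.
  move=> [/andP[z1 z2]|/andP[z1 z2]]; first by rewrite z1 (le_trans z2).
  by rewrite z2 andbT (le_lt_trans _ z1)// ler_pdivrMr//; lra.
rewrite ge0_integral_setU//=; [|exact: measurable_annulus|
  exact: measurable_annulus|exact: measurable_vnorm_powR_EFin|
  by move=> z _; rewrite lee_fin powR_ge0|]; last first.
  apply/disj_setPS => z [/= /andP[_ z1] /andP[z2 _]].
  by have := lt_le_trans z2 z1; rewrite ltxx.
rewrite big_ord_recr/= mulrDr EFinD addeC; apply: leeD => //.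
apply: le_trans (integral_dyadic_annulus_le h0 _) _; first by rewrite subr_le0.
by rewrite subrK -!powR_mulrn ?powR_ge0 ?invr_ge0// powRAC.
Qed.

(** The least K with 2^(-K) <= a works: if K > 0, then 2^(-(K-1)) > a by minimality. *)
Lemma dyadic_approx a : 0 < a <= 1 ->
  exists K, 2^-1 ^+ K <= a /\ a / 2 <= 2^-1 ^+ K.
Proof.
move=> /andP[a0 a1].
have ex : exists K, 2^-1 ^+ K <= a.
  have /cvgrPdist_le /(_ a a0) [K _ /(_ K (leqnn K))] :
      (fun k => 2^-1 ^+ k) @ \oo --> (0 : R).
    by apply: cvg_expr; rewrite ger0_norm; lra.
  by rewrite sub0r normrN ger0_norm ?exprn_ge0 ?invr_ge0// => ?; exists K.
case: (ex_minnP ex) => -[|K] Ka Kmin; first by exists 0; split => //; lra.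
exists K.+1; split => //; rewrite exprS mulrC ler_pM2l ?invr_gt0//.
by rewrite leNgt; apply/negP => /ltW/Kmin; rewrite ltnn.
Qed.

(** For p > 0 the ratio Q = 2^(-p) is below 1, so the geometric sums stay below 1 / (1 - Q) however
    small a is. *)
Lemma integral_annulus_bounded p : 0 < p -> p <= d%:R ->
  exists2 C, 0 <= C & forall a, 0 < a <= 1 ->
    (\int[mu]_(z in annulus a 1) (vnorm z `^ (p - d%:R))%:E <= C%:E)%E.
Proof.
move=> p0 pd; set A := 2 ^+ d * 2^-1 `^ (p - d%:R).
have A0 : 0 <= A by rewrite mulr_ge0 ?powR_ge0// exprn_ge0.
set Q := 2^-1 `^ p.
have Q0 : 0 < Q by rewrite powR_gt0// invr_gt0.
have Q1 : Q < 1 by exact: half_powR_lt1.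
exists (A / (1 - Q)); first by rewrite divr_ge0// subr_ge0 ltW.
move=> a /dyadic_approx[K [Ka _]].
apply: (@le_trans _ _ (\int[mu]_(z in annulus (2^-1 ^+ K) 1)
   (vnorm z `^ (p - d%:R))%:E)%E).
  apply: ge0_subset_integral; [exact: measurable_annulus|
    exact: measurable_annulus|exact: measurable_vnorm_powR_EFin|
    by move=> z _; rewrite lee_fin powR_ge0|].
  by move=> z /andP[z1 z2]; rewrite /annulus /= z2 andbT (le_lt_trans Ka).
apply: le_trans (integral_annulus_le_geometric K pd) _.
rewrite lee_fin ler_wpM2l// -/Q -[leRHS]mul1r ler_pdivlMr ?subr_gt0//.
rewrite mulrC -opprB mulNr -subrX1 opprB gerBl exprn_ge0// ltW//.
Qed.

(** Here the ratio Q = 2^s exceeds 1, and the geometric sum is at most Q^K / (Q - 1). *)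
Lemma integral_annulus_le_powR s : 0 < s ->
  exists2 C, 0 <= C & forall a, 0 < a <= 1 ->
    (\int[mu]_(z in annulus a 1) (vnorm z `^ (- s - d%:R))%:E
      <= (C * a `^ (- s))%:E)%E.
Proof.
move=> s0; set A := 2 ^+ d * 2^-1 `^ (- s - d%:R).
have A0 : 0 <= A by rewrite mulr_ge0 ?powR_ge0// exprn_ge0.
set Q := 2^-1 `^ (- s).
have Q1 : 1 < Q.
  by rewrite /Q powRN invf_gt1 ?powR_gt0 ?invr_gt0// half_powR_lt1.
(* The last factor Q pays for rounding a down to a dyadic radius: 2^(-K) >= a / 2 gives Q^K <= (a /
   2)^(-s) = Q a^(-s). *)
exists (A / (Q - 1) * Q).
  by rewrite mulr_ge0 ?divr_ge0// ?subr_ge0 ltW// (lt_trans _ Q1).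
move=> a /[dup] /andP[a0 a1] /dyadic_approx[K [Ka aK]].
apply: (@le_trans _ _ (\int[mu]_(z in annulus (2^-1 ^+ K) 1)
   (vnorm z `^ (- s - d%:R))%:E)%E).
  apply: ge0_subset_integral; [exact: measurable_annulus|
    exact: measurable_annulus|exact: measurable_vnorm_powR_EFin|
    by move=> z _; rewrite lee_fin powR_ge0|].
  by move=> z /andP[z1 z2]; rewrite /annulus /= z2 andbT (le_lt_trans Ka).
have sd : - s <= d%:R by rewrite (@le_trans _ _ 0) ?oppr_le0 ?ler0n// ltW.
apply: le_trans (integral_annulus_le_geometric K sd) _.
rewrite lee_fin -/A -/Q.
have -> : A / (Q - 1) * Q * a `^ (- s) = A * ((Q - 1)^-1 * (Q * a `^ (- s))).
  by rewrite !mulrA.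
apply: ler_wpM2l => //.
rewrite ler_pdivlMl ?subr_gt0// -subrX1.
apply: (@le_trans _ _ (Q ^+ K)); first by rewrite gerBl.
rewrite /Q -powRM ?invr_ge0 ?(ltW a0)//.
rewrite -powR_mulrn ?powR_ge0// powRAC powR_mulrn ?invr_ge0//.
rewrite le0_ler_powR ?mulr_gt0 ?invr_gt0 ?oppr_le0 ?(ltW s0)//.
by rewrite mulrC.
Qed.

End annulus_integral.

(** * Limits as the distance tends to zero *)

Section small_distance_limits.
Context {R : realType} {d : nat}.
Implicit Types (x y z : Rvec R d) (F : Rvec R d -> Rvec R d -> \bar R).

Lemma abse_le_fin (u : \bar R) (e : R) :
  (`|u| <= e%:E)%E = ((- e)%:E <= u <= e%:E)%E.
Proof. by case: u => [u||]; rewrite /= ?lee_fin ?ler_norml ?leye_eq ?leeNy_eq ?andbF. Qed.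

Lemma sup_dist_cvg0_of_small F : (0 < d)%N ->
  (forall e : R, 0 < e -> exists2 r : R, 0 < r &
     forall x y, 0 < vdist x y < r -> (`|F x y| <= e%:E)%E) ->
  sup_dist_cvg0 F.
Proof.
move=> d0 small.
have sup_small (e : R) : 0 < e -> \forall r \near 0^'+,
    (`|ereal_sup [set s | exists x y, (0 < vdist x y <= r)%R /\ s = F x y]|
       <= e%:E)%E.
  move=> e0; have [r0 r00 Fe] := small _ e0.
  near=> r.
  have rr0 : r < r0 by near: r; exact: nbhs_right_lt.
  have r_gt0 : 0 < r by near: r; exact: nbhs_right_gt.
  have Fe' x y : 0 < vdist x y <= r -> ((- e)%:E <= F x y <= e%:E)%E.
    move=> /andP[xy0 xyr]; rewrite -abse_le_fin Fe//.
    by rewrite xy0 (le_lt_trans xyr).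
  rewrite abse_le_fin; apply/andP; split.
    (* The lower bound on the supremum needs one admissible pair; distance exactly r is attained. *)
    have [x [y xy]] := vdist_exists d0 r_gt0.
    have xyr : 0 < vdist x y <= r by rewrite xy r_gt0 lexx.
    apply: ereal_sup_ge; exists (F x y); first by exists x, y.
    by have /andP[] := Fe' _ _ xyr.
  by apply: ge_ereal_sup => _ [x [y [xyr ->]]]; have /andP[] := Fe' _ _ xyr.
apply/fine_cvgP; split.
  near=> r.
  have : (`|ereal_sup [set s | exists x y, (0 < vdist x y <= r)%R /\ s = F x y]|
       <= 1%:E)%E by near: r; exact: sup_small.
  by rewrite fin_num_abs => /le_lt_trans; apply; rewrite ltry.
apply/cvgrPdist_le => e e0; near=> r.
have : (`|ereal_sup [set s | exists x y, (0 < vdist x y <= r)%R /\ s = F x y]|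
     <= e%:E)%E by near: r; exact: sup_small.
by rewrite sub0r normrN /=; case: ereal_sup => [s||].
Unshelve. all: by end_near. Qed.

Lemma cvge0_at_right (g : R -> \bar R) (e : R) : 0 < e ->
  g r @[r --> 0^'+] --> 0%E -> exists2 r, 0 < r & (g r <= e%:E)%E.
Proof.
move=> e0 /fine_cvgP[gfin /cvgrPdist_le /(_ e e0) ge].
near (0 : R)^'+ => r; exists r; first by near: r; exact: nbhs_right_gt.
have gr : g r \is a fin_num by near: r.
have : `|0 - fine (g r)| <= e by near: r.
by rewrite -(fineK gr) lee_fin sub0r normrN; exact/le_trans/ler_norm.
Unshelve. all: by end_near. Qed.

(** One radius with a small supremum suffices, since that supremum covers all smaller distances. *)
Lemma sup_dist_cvg0_small F (e : R) : sup_dist_cvg0 F -> 0 < e ->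
  exists2 r : R, 0 < r & forall x y, 0 < vdist x y < r -> (F x y <= e%:E)%E.
Proof.
move=> /cvge0_at_right F0 /F0[r r0 re]; exists r => // x y /andP[xy0 xyr].
apply: le_trans re; apply: ereal_sup_ubound; exists x, y.
by rewrite xy0 ltW.
Qed.

Lemma vdist_ge0 x y : 0 <= vdist x y.
Proof. exact: vnorm_ge0. Qed.

Lemma vdistxx x : vdist x x = 0.
Proof.
rewrite /vdist /vnorm /vdot big1 ?sqrtr0// => i _.
by rewrite tnth_mktuple subrr mulr0.
Qed.

(** [H3] controls the sum of two oscillations. The one in z is nonnegative, as z1 = z2 shows, so the
    one in x inherits the bound. *)
Lemma H3_osc_x (n : Rvec R d -> Rvec R d -> R) (e : R) : H3 n -> 0 < e ->
  exists2 r : R, 0 < r & forall x y z, vnorm z <= 1 -> vdist x y < r ->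
    `|n x z - n y z| <= e.
Proof.
move=> [_ /cvge0_at_right n0] /n0[r r0 re]; exists r => // x y z z1 xyr.
rewrite -lee_fin; apply: le_trans re.
have osc_z : (0 <= n_osc_z n r)%E.
  apply: ereal_sup_ge; exists `|n x z - n x z|%:E.
    by exists x, z, z; rewrite vdistxx ltW.
  by rewrite lee_fin.
apply: (@le_trans _ _ (n_osc_x n r)); last exact: leeDr.
by apply: ereal_sup_ubound; exists x, y, z; split => //; exact: ltW.
Qed.

End small_distance_limits.

(** * Pointwise bounds for the difference of two densities *)

Section density_estimates.
Context {R : realType}.
Implicit Types (a b t c e h p q D : R).

(** Inverting exp(-t) >= 1 - t gives (1 - t) exp t <= 1, hence exp t <= 2 and exp t - 1 <= t exp t
    <= 2 t. *)
Lemma expR_le_linear t : 0 <= t -> t <= 2^-1 -> expR t - 1 <= 2 * t.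
Proof.
move=> t0 t1; have := expR_ge1Dx (- t); rewrite expRN => h.
have e0 := expR_gt0 t.
have : (1 - t) * expR t <= 1 by rewrite -ler_pdivlMr// div1r.
by nra.
Qed.

Lemma powRN_sub1_ge0 t h : 0 < t <= 1 -> 0 <= h -> 0 <= t `^ (- h) - 1.
Proof.
move=> t01 h0; rewrite subr_ge0 -(powRr0 t).
by rewrite ger_powR// oppr_le0.
Qed.

(** Trades a logarithm for an arbitrarily small power: with L = ln t, exp u - 1 <= u exp u at u = -
    h L, and - e L <= exp (- e L). *)
Lemma powRN_sub1_le t h e : 0 < t <= 1 -> 0 <= h -> 0 < e ->
  t `^ (- h) - 1 <= h / e * t `^ (- h - e).
Proof.
move=> /andP[t0 t1] h0 e0.
have t_neq0 : t != 0 by rewrite gt_eqF.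
rewrite powRD ?t_neq0 ?implybT// /powR gt_eqF//.
set L := ln t.
have L0 : L <= 0 by rewrite ln_le0.
have h1 := expR_ge1Dx (h * L).
have h2 := expR_ge1Dx (- e * L).
have E1 : expR (- h * L) = (expR (h * L))^-1 by rewrite mulNr expRN.
have p0 := expR_gt0 (h * L).
have a1 : expR (- h * L) - 1 <= - h * L * expR (- h * L).
  have : (1 + h * L) * expR (- h * L) <= 1.
    by rewrite E1 ler_pdivrMr// mul1r.
  by nra.
apply: le_trans a1 _.
rewrite (_ : _ / e * _ = (h / e * expR (- e * L)) * expR (- h * L)); last by ring.
rewrite ler_wpM2r ?expR_ge0//.
rewrite mulNr -mulrN -mulrA ler_wpM2l// mulrC ler_pdivlMr//.
by lra.
Qed.

(** The bound is symmetric, so a <= b may be assumed. With v = t^(-(D + a)) and u = t^(-(b - a)) >=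
    1 the difference is (na - nb) v - nb (u - 1) v. *)
Lemma density_difference_le t D (a b na nb : R) c : 0 < t <= 1 ->
  0 <= na <= c -> 0 <= nb <= c ->
  `|na / t `^ (D + a) - nb / t `^ (D + b)| <=
  (`|na - nb| + c * (t `^ (- `|a - b|) - 1)) * t `^ (- (D + Num.min a b)).
Proof.
wlog ab : a b na nb / a <= b.
  move=> H; case: (leP a b) => [|/ltW] ab t01 hna hnb.
    by have := H _ _ _ _ ab t01 hna hnb; rewrite (min_idPl ab).
  have := H _ _ _ _ ab t01 hnb hna.
  by rewrite distrC (distrC nb) (distrC b) (min_idPl ab).
move=> /[dup] t01 /andP[t0 t1] /andP[na0 nac] /andP[nb0 nbc].
rewrite (min_idPl ab) (distrC a) (ger0_norm (x := b - a)) ?subr_ge0//.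
have t_neq0 : t != 0 by rewrite gt_eqF.
rewrite -!powRN.
have -> : - (D + b) = - (b - a) + - (D + a) by lra.
rewrite powRD ?t_neq0 ?implybT//.
set u := t `^ (- (b - a)); set v := t `^ _.
have v0 : 0 <= v by exact: powR_ge0.
have u1 : 0 <= u - 1 by rewrite powRN_sub1_ge0// subr_ge0.
rewrite (_ : _ - _ = (na - nb) * v - nb * (u - 1) * v); last by ring.
rewrite (le_trans (ler_normB _ _))// [leRHS]mulrDl.
rewrite !normrM (ger0_norm v0) (ger0_norm nb0) (ger0_norm u1).
by rewrite lerD2l ler_wpM2r// ler_wpM2r.
Qed.

End density_estimates.

(** * Reduction of the drift integral to the integral of a power *)

Section drift_bound.
Context {R : realType} {d : nat}.
Variables (alpha : Rvec R d -> R) (n : Rvec R d -> Rvec R d -> R).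
Hypothesis measurable_n : measurable_fun [set: Rvec R d * Rvec R d]
  (fun p : Rvec R d * Rvec R d => n p.1 p.2).

Lemma measurable_jump_density x :
  measurable_fun [set: Rvec R d] (jump_density alpha n x).
Proof.
rewrite (_ : jump_density alpha n x = n x \*
    (fun z => vnorm z `^ (- (d%:R + alpha x)))); last first.
  by apply/funext => z; rewrite /jump_density /= powRN.
apply: measurable_funM; last exact: measurable_vnorm_powR.
exact: (measurable_fun_pair2 x measurable_n).
Qed.

(** Absolute values go inside the integral, and [vdot_le] splits the inner product into d |x - y|
    and a factor |z|, which is left to the pointwise hypothesis. *)
Lemma drift_difference_le x y (c q : R) : 0 <= c ->
  (forall z, vdist x y / 2 < vnorm z <= 1 ->
    vnorm z * `|jump_density alpha n y z - jump_density alpha n x z|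
      <= c * vnorm z `^ q) ->
  (`|drift_difference alpha n x y| <= (d%:R * vdist x y * c)%:E *
    \int[lebesgue_vec R d]_(z in annulus (vdist x y / 2) 1)
      (vnorm z `^ q)%:E)%E.
Proof.
move=> c0 jc; rewrite /drift_difference -/(annulus (vdist x y / 2) 1).
have mA := @measurable_annulus R d (vdist x y / 2) 1.
have mf : measurable_fun [set: Rvec R d] (fun z : Rvec R d =>
    (vdot (vsub x y) z *
      (jump_density alpha n y z - jump_density alpha n x z))%:E).
  apply/measurable_EFinP; apply: measurable_funM; first exact: measurable_vdot.
  by apply: measurable_funB; exact: measurable_jump_density.
apply: le_trans (le_abse_integral _ mA (measurable_funTS mf)) _.
have K0 : 0 <= d%:R * vdist x y * c.
  by rewrite mulr_ge0 ?mulr_ge0 ?ler0n ?vdist_ge0.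
rewrite -ge0_integralZl//=; last 2 first.
- exact: measurable_vnorm_powR_EFin.
- by move=> z _; rewrite lee_fin powR_ge0.
apply: ge0_le_integral => //.
- exact: (measurableT_comp (@abse_measurable R setT) (measurable_funTS mf)).
- by apply: measurable_funeM; exact: measurable_vnorm_powR_EFin.
move=> z az; rewrite -EFinM lee_fin normrM.
apply: (@le_trans _ _ (d%:R * vdist x y * (vnorm z *
    `|jump_density alpha n y z - jump_density alpha n x z|))).
  by rewrite mulrA ler_wpM2r//; exact: vdot_le.
by rewrite -[leRHS]mulrA ler_wpM2l ?jc// mulr_ge0 ?ler0n// vdist_ge0.
Qed.

End drift_bound.

(** * Scaling of powers of the distance *)

Section power_estimates.
Context {R : realType}.
Implicit Types delta h e m : R.

(** The power is the exponential of h ln (1 / delta) + h ln 2. As delta <= 1/2, ln 2 <= ln (1 /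
    delta), so the exponent is at most 2 e <= 1/2 and [expR_le_linear] applies. *)
Lemma half_powRN_sub1_le delta h e : 0 < delta <= 2^-1 -> 0 <= h ->
  h * ln (1 / delta) <= e -> e <= 4^-1 -> (delta / 2) `^ (- h) - 1 <= 4 * e.
Proof.
move=> /andP[delta0 delta2] h0 he e4.
rewrite /powR gt_eqF ?divr_gt0//.
have ln_half : ln (delta / 2) = - ln (1 / delta) - ln 2.
  by rewrite div1r lnV ?posrE// opprK lnM ?posrE ?invr_gt0// lnV ?posrE.
have ln2 : ln 2 <= ln (1 / delta).
  by rewrite ler_ln ?posrE ?divr_gt0// ler_pdivlMr//; lra.
have ln2_ge0 : 0 <= ln 2 :> R by rewrite ln_ge0//; lra.
have hln2 : h * ln 2 <= e by rewrite (le_trans _ he)// ler_wpM2l.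
have E : - h * ln (delta / 2) = h * ln (1 / delta) + h * ln 2.
  by rewrite ln_half; ring.
have E0 : 0 <= h * ln 2 by rewrite mulr_ge0.
have E1 : 0 <= h * ln (1 / delta) by rewrite mulr_ge0// (le_trans _ ln2).
apply: le_trans (expR_le_linear _ _) _; rewrite E; lra.
Qed.

Lemma powR_scale delta m : 0 < delta ->
  delta `^ (m - 2) * delta * delta `^ (1 - m) = 1.
Proof.
move=> delta0; have delta_neq0 : delta != 0 by rewrite gt_eqF.
rewrite -{2}(powRr1 (ltW delta0)) -!powRD ?delta_neq0 ?implybT//.
by rewrite (_ : _ + _ = 0) ?powRr0//; ring.
Qed.

(** Halving delta costs (1/2)^(1 - m) = 2^(m - 1), at most 2 because m <= 2. *)
Lemma powR_scale_half_le delta m : 0 < delta -> m <= 2 ->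
  delta `^ (m - 2) * delta * (delta / 2) `^ (1 - m) <= 2.
Proof.
move=> delta0 m2; rewrite powRM ?(ltW delta0)// mulrA powR_scale// mul1r.
rewrite -[2^-1]powR_inv1// -powRrM -[leRHS](powRr1 (ler0n _ 2)).
by rewrite ler_powR; lra.
Qed.

(** [powRN_sub1_le] with e := p leaves t to the powers 1 - D - m and 1 - h - p - D - m. As m + h <=
    1 - 2 p, both exponents are at least p - D, and t <= 1. *)
Lemma small_index_integrand_le (t N c p h m D : R) : 0 < t <= 1 ->
  0 <= h -> h <= N -> 0 <= c -> 0 < p -> m + h <= 1 - 2 * p ->
  t * ((N + c * (t `^ (- h) - 1)) * t `^ (- (D + m))) <=
  N * (1 + c / p) * t `^ (p - D).
Proof.
move=> /[dup] t01 /andP[t0 t1] h0 hN c0 p0 hm.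
have N0 : 0 <= N by exact: le_trans hN.
have pow_le q : p - D <= q -> t `^ q <= t `^ (p - D).
  by move=> ?; rewrite ger_powR.
have mulr_pow q : t * t `^ q = t `^ (1 + q).
  by rewrite powRD ?(gt_eqF t0) ?implybT// powRr1// ltW.
apply: (@le_trans _ _ (t * ((N + c * (h / p * t `^ (- h - p))) *
    t `^ (- (D + m))))).
  rewrite ler_wpM2l ?(ltW t0)// ler_wpM2r ?powR_ge0// lerD2l.
  by rewrite ler_wpM2l// powRN_sub1_le.
rewrite (_ : _ * _ = N * (t * t `^ (- (D + m))) + c / p * h *
  (t * (t `^ (- h - p) * t `^ (- (D + m))))); last by ring.
rewrite -powRD ?(gt_eqF t0) ?implybT// !mulr_pow.
rewrite mulrDr mulr1 mulrDl (mulrC N (c / p)).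
have ? : t `^ (1 + - (D + m)) <= t `^ (p - D) by apply: pow_le; lra.
have ? : t `^ (1 + (- h - p - (D + m))) <= t `^ (p - D) by apply: pow_le; lra.
have cp0 : 0 <= c / p by rewrite divr_ge0// ltW.
apply: lerD; first by rewrite ler_wpM2l.
apply: ler_pM => //; [exact: mulr_ge0|exact: powR_ge0|exact: ler_wpM2l].
Qed.

End power_estimates.

(** * The cases alpha > 1 and alpha < 1, and the Lipschitz criterion *)

Section drift_conditions.
Context {R : realType} {d : nat}.
Variables (alpha : Rvec R d -> R) (n : Rvec R d -> Rvec R d -> R).
Hypothesis d_gt0 : (0 < d)%N.
Hypothesis measurable_n : measurable_fun [set: Rvec R d * Rvec R d]
  (fun p : Rvec R d * Rvec R d => n p.1 p.2).
Implicit Types x y z : Rvec R d.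

Lemma jump_density_difference_le x y z (c : R) : 0 < vnorm z <= 1 ->
  (forall x z, 0 <= n x z <= c) ->
  `|jump_density alpha n y z - jump_density alpha n x z| <=
  (`|n x z - n y z| + c * (vnorm z `^ (- `|alpha x - alpha y|) - 1)) *
    vnorm z `^ (- (d%:R + Num.min (alpha x) (alpha y))).
Proof. by move=> z01 nc; rewrite distrC; exact: density_difference_le. Qed.

(** The index m depends on the pair, whereas the constant of the integral bound must not. So the
    integral is taken at the fixed exponent - (a - 1) - d, and the remaining |z|^(a - m) is bounded
    by its value at radius delta / 2, as a <= m. *)
Lemma drift_condition_gt1 (a : R) : 1 < a ->
  (forall x, a <= alpha x <= 2) -> H2 alpha -> H3 n ->
  (forall x z, 0 <= n x z) -> drift_condition alpha n.
Proof.
move=> a1 alpha_a [_ alpha_log] nH3 n0.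
have [[c1 [c [_ c0 nc]]] _] := nH3.
have {}nc x z : 0 <= n x z <= c by rewrite n0; have /andP[] := nc x z.
have s0 : 0 < a - 1 by rewrite subr_gt0.
have [C C0 HC] := @integral_annulus_le_powR R d _ s0.
apply: sup_dist_cvg0_of_small => // e e0.
(* The factors: d from [vdot_le], C from the integral, 2 from [powR_scale_half_le], 1 + 4 c from the
   densities. *)
pose K := d%:R * C * 2 * (1 + 4 * c).
have K0 : 0 <= K by rewrite !mulr_ge0 ?ler0n//; lra.
(* The bound 1/4 is what [half_powRN_sub1_le] asks for; K + 1 avoids a division by zero. *)
pose e1 := Num.min 4^-1 (e / (K + 1)).
have e10 : 0 < e1 by rewrite lt_min invr_gt0 divr_gt0// ltr_wpDl.
have e14 : e1 <= 4^-1 by rewrite ge_min lexx.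
have e1K : K * e1 <= e.
  apply: (@le_trans _ _ ((K + 1) * e1)); first by rewrite ler_wpM2r ?lerDl ?(ltW e10).
  by rewrite mulrC -ler_pdivlMr ?ltr_wpDl// ge_min lexx orbT.
have [r1 r10 Hr1] := alpha_log _ e10.
have [r2 r20 Hr2] := H3_osc_x nH3 e10.
exists (Num.min 2^-1 (Num.min r1 r2)); first by rewrite !lt_min r10 r20 invr_gt0 ltr0n.
move=> x y; rewrite !lt_min => /andP[delta0 /and3P[delta2 deltar1 deltar2]].
have hlog : `|alpha x - alpha y| * ln (1 / vdist x y) <= e1.
  apply: le_trans (ler_norm _) _; apply/ltW.
  by apply: Hr1; rewrite delta0.
have pow_le := half_powRN_sub1_le (e := e1) (delta := vdist x y)
  (h := `|alpha x - alpha y|).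
have {}pow_le : (vdist x y / 2) `^ (- `|alpha x - alpha y|) - 1 <= 4 * e1.
  by apply: pow_le => //; rewrite delta0 ltW.
set delta := vdist x y in delta0 delta2 deltar1 deltar2 hlog pow_le *.
set h := `|alpha x - alpha y| in hlog pow_le.
have h0 : 0 <= h by exact: normr_ge0.
pose m := Num.min (alpha x) (alpha y).
have am : a <= m.
  by rewrite le_min; have /andP[-> _] := alpha_a x; have /andP[-> _] := alpha_a y.
have m2 : m <= 2 by rewrite ge_min; have /andP[_ ->] := alpha_a x.
have half0 : 0 < delta / 2 by rewrite divr_gt0.
have half1 : delta / 2 <= 1 by lra.
(* e1 bounds the oscillation of n, and 4 c e1 the term from the differing powers. *)
pose eta := (1 + 4 * c) * e1.
have eta0 : 0 <= eta by rewrite mulr_ge0 ?(ltW e10)//; lra.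
have pointwise z : delta / 2 < vnorm z <= 1 ->
    vnorm z * `|jump_density alpha n y z - jump_density alpha n x z|
      <= eta * (delta / 2) `^ (a - m) * vnorm z `^ (- (a - 1) - d%:R).
  move=> /andP[z1 z2]; have z0 : 0 < vnorm z by exact: lt_trans z1.
  have z_neq0 : vnorm z != 0 by rewrite gt_eqF.
  have z01 : 0 < vnorm z <= 1 by rewrite z0.
  apply: (@le_trans _ _ (vnorm z * (eta * vnorm z `^ (- (d%:R + m))))).
    rewrite ler_wpM2l ?(ltW z0)//.
    apply: le_trans (jump_density_difference_le _ _ z01 nc) _.
    rewrite -/h -/m ler_wpM2r ?powR_ge0//.
    rewrite /eta mulrDl mul1r lerD//; first exact: Hr2.
    rewrite (mulrC 4) -mulrA ler_wpM2l ?(ltW c0)//.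
    apply: le_trans pow_le; rewrite lerB// le0_ler_powR ?oppr_le0//.
    exact: ltW.
  rewrite mulrCA -mulrA ler_wpM2l//.
  rewrite -{1}(powRr1 (ltW z0)) -powRD ?z_neq0 ?implybT//.
  rewrite (_ : 1 + _ = (a - m) + (- (a - 1) - d%:R)); last by ring.
  rewrite powRD ?z_neq0 ?implybT// ler_wpM2r ?powR_ge0//.
  by rewrite le0_ler_powR ?subr_le0// ltW.
have c'0 : 0 <= eta * (delta / 2) `^ (a - m) by rewrite mulr_ge0 ?powR_ge0.
rewrite abseM gee0_abs ?lee_fin ?powR_ge0//.
apply: (@le_trans _ _ ((delta `^ (m - 2))%:E *
  ((d%:R * delta * (eta * (delta / 2) `^ (a - m)))%:E *
   (C * (delta / 2) `^ (- (a - 1)))%:E))%E).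
  apply: lee_wpmul2l; first by rewrite lee_fin powR_ge0.
  apply: le_trans (drift_difference_le measurable_n c'0 pointwise) _.
  apply: lee_wpmul2l; last by apply: HC; rewrite half0.
  by rewrite lee_fin mulr_ge0// mulr_ge0 ?ler0n ?vdist_ge0.
rewrite -!EFinM lee_fin.
have -> : delta `^ (m - 2) * (d%:R * delta * (eta * (delta / 2) `^ (a - m)) *
    (C * (delta / 2) `^ (- (a - 1)))) =
  d%:R * C * eta * (delta `^ (m - 2) * delta *
    ((delta / 2) `^ (a - m) * (delta / 2) `^ (- (a - 1)))) by ring.
rewrite -powRD ?(gt_eqF half0) ?implybT//.
(* The auxiliary exponent a drops out when the powers of delta / 2 merge. *)
rewrite (_ : a - m + _ = 1 - m); last by ring.
apply: le_trans e1K; rewrite (_ : K * e1 = d%:R * C * eta * 2); last first.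
  by rewrite /K /eta; ring.
by rewrite ler_wpM2l ?powR_scale_half_le// mulr_ge0// mulr_ge0 ?ler0n.
Qed.

(** Brings the modulus hypothesis back to real numbers: the denominator is positive and finite, and
    each term is below the supremum. *)
Lemma modulus_le x y (e : R) : 0 < vdist x y ->
  ((`|alpha x - alpha y|%:E
      + ereal_sup [set `|n x z - n y z|%:E | z in [set z | (vnorm z <= 1)%R]])
     / (vdist x y `^ (1 - Num.min (alpha x) (alpha y)))%:E <= e%:E)%E ->
  forall z, vnorm z <= 1 -> `|alpha x - alpha y| + `|n x z - n y z|
    <= e * vdist x y `^ (1 - Num.min (alpha x) (alpha y)).
Proof.
move=> delta0; rewrite inver gt_eqF ?powR_gt0// lee_pdivrMr ?lte_fin ?powR_gt0// -EFinM => He z z1.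
rewrite -lee_fin EFinD; apply: le_trans He; rewrite leeD2l//.
by apply: ereal_sup_ubound; exists z.
Qed.

(** The modulus hypothesis bounds both h and the variation of n by N = e1 delta^(1 - m), while the
    power integral stays bounded. *)
Lemma drift_condition_lt1 (a : R) : a < 1 ->
  (forall x, 0 <= alpha x <= a) -> H3 n -> (forall x z, 0 <= n x z) ->
  modulus_condition alpha n -> drift_condition alpha n.
Proof.
move=> a1 alpha_a [[c1 [c [_ c0 nc]]] _] n0 modulus.
have {}nc x z : 0 <= n x z <= c by rewrite n0; have /andP[] := nc x z.
have a0 : 0 <= a.
  by have /andP[] := alpha_a [tuple 0 | i < d]; exact: le_trans.
(* Chosen so that 1 - 2 p = a, an upper bound for m + h, the larger of alpha x and alpha y. *)
pose p := (1 - a) / 2.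
have p0 : 0 < p by rewrite /p; lra.
have pd : p <= d%:R.
  by apply: (@le_trans _ _ 1); [rewrite /p; lra|rewrite ler1n].
have [C C0 HC] := integral_annulus_bounded p0 pd.
apply: sup_dist_cvg0_of_small => // e e0.
pose K := d%:R * C * (1 + c / p).
have cp0 : 0 <= c / p by rewrite divr_ge0// ltW.
have K0 : 0 <= K by rewrite !mulr_ge0 ?ler0n//; lra.
pose e1 := e / (K + 1).
have e10 : 0 < e1 by rewrite divr_gt0// ltr_wpDl.
have e1K : K * e1 <= e.
  apply: (@le_trans _ _ ((K + 1) * e1)); first by rewrite ler_wpM2r ?lerDl ?(ltW e10).
  by rewrite mulrC -ler_pdivlMr ?ltr_wpDl.
have [r r0 Hr] := sup_dist_cvg0_small modulus e10.
exists (Num.min 1 r); first by rewrite lt_min r0 ltr01.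
move=> x y; rewrite lt_min => /and3P[delta0 delta1 deltar].
have xyr : 0 < vdist x y < r by rewrite delta0.
have Mxy := modulus_le delta0 (Hr _ _ xyr).
set delta := vdist x y in delta0 delta1 deltar xyr Mxy *.
pose m := Num.min (alpha x) (alpha y).
rewrite -/m in Mxy *.
have [N NE] : exists N, N = e1 * delta `^ (1 - m) by exists (e1 * delta `^ (1 - m)).
rewrite -NE in Mxy.
set h := `|alpha x - alpha y| in Mxy.
have h0 : 0 <= h by exact: normr_ge0.
have hN : h <= N.
  (* The zero vector, written as x - x, is a point of the unit ball at which to apply [Mxy]. *)
  have z1 : vnorm (vsub x x) <= 1 by rewrite -/(vdist x x) vdistxx.
  by apply: le_trans (Mxy _ z1); rewrite lerDl.
have N0 : 0 <= N by exact: le_trans hN.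
have hm : m + h <= 1 - 2 * p.
  rewrite (_ : 1 - 2 * p = a); last by rewrite /p; lra.
  rewrite /m /h; have /andP[_ ax] := alpha_a x; have /andP[_ ay] := alpha_a y.
  by case: (leP (alpha x) (alpha y)) => hxy;
    [rewrite ler0_norm ?subr_le0//; lra|rewrite gtr0_norm ?subr_gt0//; lra].
have pointwise z : delta / 2 < vnorm z <= 1 ->
    vnorm z * `|jump_density alpha n y z - jump_density alpha n x z|
      <= N * (1 + c / p) * vnorm z `^ (p - d%:R).
  move=> /andP[z1 z2]; have z0 : 0 < vnorm z by apply: lt_trans z1; rewrite divr_gt0.
  have z01 : 0 < vnorm z <= 1 by rewrite z0.
  apply: le_trans (small_index_integrand_le _ z01 h0 hN (ltW c0) p0 hm).
  rewrite ler_wpM2l ?(ltW z0)//.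
  apply: le_trans (jump_density_difference_le _ _ z01 nc) _.
  rewrite -/h -/m ler_wpM2r ?powR_ge0// lerD2r.
  by apply: le_trans (Mxy _ z2); rewrite lerDr.
have c'0 : 0 <= N * (1 + c / p) by rewrite mulr_ge0//; lra.
rewrite abseM gee0_abs ?lee_fin ?powR_ge0//.
apply: (@le_trans _ _ ((delta `^ (m - 2))%:E *
  ((d%:R * delta * (N * (1 + c / p)))%:E * C%:E))%E).
  apply: lee_wpmul2l; first by rewrite lee_fin powR_ge0.
  apply: le_trans (drift_difference_le measurable_n c'0 pointwise) _.
  apply: lee_wpmul2l; last first.
    by apply: HC; rewrite -/delta divr_gt0//= ler_pdivrMr//; lra.
  by rewrite lee_fin mulr_ge0// mulr_ge0 ?ler0n ?vdist_ge0.
rewrite -!EFinM lee_fin.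
(* N supplies the delta^(1 - m) that cancels the prefactor. *)
rewrite (_ : _ * _ = K * e1 * (delta `^ (m - 2) * delta * delta `^ (1 - m))).
  by rewrite powR_scale// mulr1.
by rewrite NE /K; ring.
Qed.

(** The quotient is at most L delta / delta^(1 - m) = L delta^m <= L delta^a for delta <= 1, which
    tends to 0 uniformly as a > 0. *)
Lemma modulus_condition_lipschitz (a : R) : 0 < a ->
  (forall x, a <= alpha x) -> alpha_lipschitz alpha -> n_lipschitz n ->
  modulus_condition alpha n.
Proof.
move=> a0 alpha_a [L1 HL1] [L2 HL2].
apply: sup_dist_cvg0_of_small => // e e0.
(* The Lipschitz constants come without a sign, hence the absolute values. *)
pose L : R := `|L1| + `|L2|.
have L0 : 0 <= L by rewrite addr_ge0.
have eL0 : 0 < e / (L + 1) by rewrite divr_gt0// ltr_wpDl.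
(* The second radius solves (L + 1) delta^a = e. *)
exists (Num.min 1 ((e / (L + 1)) `^ a^-1)).
  by rewrite lt_min ltr01 powR_gt0.
move=> x y; rewrite lt_min => /and3P[delta0 delta1 deltae].
set delta := vdist x y in delta0 delta1 deltae *.
pose m := Num.min (alpha x) (alpha y).
have am : a <= m by rewrite le_min !alpha_a.
rewrite -/m; set S := ereal_sup _.
have S0 : (0 <= S)%E.
  apply: ereal_sup_ge; exists `|n x (vsub x x) - n y (vsub x x)|%:E.
    by exists (vsub x x) => //=; rewrite -/(vdist x x) vdistxx.
  by rewrite lee_fin.
have SL : (S <= (`|L2| * delta)%:E)%E.
  apply: ge_ereal_sup => _ [z z1 <-]; rewrite lee_fin.
  by apply: le_trans (HL2 _ _ _ z1) _; rewrite ler_wpM2r ?ler_norm// ltW.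
have hL : `|alpha x - alpha y| <= `|L1| * delta.
  by apply: le_trans (HL1 _ _) _; rewrite ler_wpM2r ?ler_norm// ltW.
have pow0 : 0 < delta `^ (1 - m) by rewrite powR_gt0.
rewrite gee0_abs; last first.
  by rewrite mule_ge0 ?adde_ge0 ?lee_fin// inver gt_eqF// lee_fin invr_ge0 ltW.
rewrite inver gt_eqF// lee_pdivrMr// -EFinM.
apply: (@le_trans _ _ ((`|L1| * delta)%:E + (`|L2| * delta)%:E)%E).
  by apply: leeD => //; rewrite lee_fin.
rewrite -EFinD lee_fin -mulrDl -/L.
have -> : L * delta = L * (delta `^ m * delta `^ (1 - m)).
  rewrite -powRD ?(gt_eqF delta0) ?implybT// (_ : m + (1 - m) = 1); last by ring.
  by rewrite powRr1// ltW.
rewrite mulrA ler_wpM2r ?powR_ge0//.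
apply: (@le_trans _ _ ((L + 1) * delta `^ a)).
  apply: ler_pM; rewrite ?powR_ge0 ?lerDl//.
  by apply: ger_powR => //; rewrite delta0 (ltW delta1).
rewrite mulrC -ler_pdivlMr ?ltr_wpDl//.
have -> : e / (L + 1) = ((e / (L + 1)) `^ a^-1) `^ a.
  by rewrite -powRrM mulVf ?gt_eqF// powRr1// ltW.
by apply: ge0_ler_powR; rewrite ?nnegrE ?powR_ge0//; exact: ltW.
Qed.

End drift_conditions.

Theorem proposition1p8 (R : realType) (d : nat) (d_gt0 : (0 < d)%N)
    (alpha : Rvec R d -> R) (n : Rvec R d -> Rvec R d -> R)
    (measurable_alpha : measurable_fun [set: Rvec R d] alpha)
    (measurable_n : measurable_fun [set: Rvec R d * Rvec R d]
      (fun p : Rvec R d * Rvec R d => n p.1 p.2))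
    (alpha_range : forall x, 0 < alpha x < 2)
    (n_gt0 : forall x z, 0 < n x z)
    (alphaH2 : H2 alpha) (nH3 : H3 n) :
  (1 < inf (range alpha) -> drift_condition alpha n) /\
  ((sup (range alpha) < 1 -> modulus_condition alpha n ->
      drift_condition alpha n) /\
   (alpha_lipschitz alpha -> n_lipschitz n -> modulus_condition alpha n)).
Proof.
have alpha0 x : 0 <= alpha x by have /andP[/ltW] := alpha_range x.
have alpha2 x : alpha x <= 2 by have /andP[_ /ltW] := alpha_range x.
have n_ge0 x z : 0 <= n x z by exact: ltW.
split=> [inf1|]; [|split=> [sup1|]].
- apply: (drift_condition_gt1 d_gt0 measurable_n inf1) => // x.
  (* The infimum is a lower bound only for a range bounded below; 0 serves here, and 2 serves for
     the supremum in the next case. *)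
  rewrite alpha2 andbT; apply: ge_inf; last by exists x.
  by exists 0 => _ [y _ <-].
- apply: (drift_condition_lt1 d_gt0 measurable_n sup1) => // x.
  rewrite alpha0 /=; apply: ub_le_sup; last by exists x.
  by exists 2 => _ [y _ <-].
(* Pointwise positivity of alpha would not do: the uniform positive lower bound comes from [H2]. *)
- have [[a [a2 [a0 _ _ alpha_a]]] _] := alphaH2.
  apply: (modulus_condition_lipschitz d_gt0 a0) => // x.
  by have /andP[] := alpha_a x.
Qed.
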